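(* Let $\lambda_0(A)$ be a $G_1$-space whose Köthe matrix $A=(a_n)_n$ satisfies $\lim_{i\to\infty}a_n(i)=0$ for all $n\in\mathbb{N}$, let $\mathsf{C}:\lambda_0(A)\to\lambda_0(A)$ be the Cesàro operator, and suppose $S_{n_0}(A)\ne\varnothing$ for some $n_0\in\mathbb{N}$. Then $$D(1)\cup\{1\}=\bigcup_{n\in\mathbb{N},\ S_n(A)\neq\varnothing}D(s_0(n))\ \cup\ \Sigma\ \subseteq\ \sigma(\mathsf{C};\lambda_0(A)).$$
   Context: $\mathbb{N}=\{1,2,3,\dots\}$. A Köthe matrix is $A=(a_n)_{n\in\mathbb{N}}$, $a_n=(a_n(i))_{i\in\mathbb{N}}$, with $0\le a_n(i)\le a_{n+1}(i)$ for all $i,n$, and such that for every $i$ there is $n$ with $a_n(i)>0$. The Köthe echelon space of order $0$ is $\lambda_0(A)=\{x\in\mathbb{C}^{\mathbb{N}}:\lim_{i\to\infty}a_n(i)x_i=0\ \forall n\in\mathbb{N}\}$, a Fréchet space with the seminorms $p_n(x)=\sup_{i}a_n(i)|x_i|$. It is called a $G_1$-space (smooth sequence space of finite type) if (G1-1) $0<a_n(i+1)\le a_n(i)$ for all $n,i\in\mathbb{N}$, and (G1-2) for all $n$ there exist $m>n$ and $C>0$ such that $a_n(i)\le C\,a_m(i)^2$ for all $i\in\mathbb{N}$. The Cesàro operator is $\mathsf{C}x=\left(\frac1i\sum_{j=1}^i x_j\right)_{i\in\mathbb{N}}$; it maps $\lambda_0(A)$ continuously into itself when (G1-1) holds. For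 a locally convex Hausdorff space $X$ let $\mathcal{L}(X)$ be the space of continuous linear operators on $X$. For $T\in\mathcal{L}(X)$ the resolvent set is the set of $\lambda\in\mathbb{C}$ such that $(\lambda I-T)^{-1}$ exists in $\mathcal{L}(X)$; the spectrum $\sigma(T;X)$ is its complement in $\mathbb{C}$. $\Sigma=\{\frac1k:k\in\mathbb{N}\}$. For $n\in\mathbb{N}$, $S_n(A)=\left\{s\in\mathbb{R}:\sum_{i=1}^\infty\frac{1}{i^s a_n(i)}<\infty\right\}$, and $s_0(n)=\inf S_n(A)$ when $S_n(A)\neq\varnothing$ (under (G1-1), $S_n(A)\subseteq S_{n+1}(A)$ and $s_0(n)\ge1$). For $r\ge1$, $D(r)=\{\lambda\in\mathbb{C}:|\lambda-\frac1{2r}|<\frac1{2r}\}$. *)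

(* Defs.v *)
From HB Require Import structures.
From mathcomp Require Import all_boot all_order all_algebra complex.
From mathcomp Require Import all_classical all_reals all_analysis.

Set Implicit Arguments.
Unset Strict Implicit.
Unset Printing Implicit Defensive.

Import Order.TTheory GRing.Theory Num.Theory.
Import numFieldNormedType.Exports.
Import ComplexField.Normc.

Local Open Scope classical_set_scope.
Local Open Scope ring_scope.
Local Open Scope complex_scope.

(** In this file [nat] indexes the positive integers: [A n i] is the entry
    a_{n+1}(i+1), and [x i] is the coordinate x_{i+1}. *)

Record kothe_matrix (R : realType) := KotheMatrix {
  kothe_entry :> nat -> nat -> R ;
  kothe_ge0 : forall n i, 0 <= kothe_entry n i ;
  kothe_le : forall n i, kothe_entry n i <= kothe_entry n.+1 i ;
  kothe_gt0 : forall i, exists n, 0 < kothe_entry n i }.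

Local Arguments normc : simpl never.

Section modulus.
Context {R : realType}.
Implicit Types z : R[i].

Lemma normr_normc z : `|z| = (normc z)%:C.
Proof. by rewrite normc_def; case: z. Qed.

Lemma normc_ge0 z : 0 <= normc z.
Proof. by case: z => a b; exact: sqrtr_ge0. Qed.

Lemma normc_real (r : R) : 0 <= r -> normc r%:C = r.
Proof. by move=> r0; rewrite /normc /= expr0n/= addr0 sqrtr_sqr ger0_norm. Qed.

Lemma normcD z z' : normc (z + z') <= normc z + normc z'.
Proof. by rewrite -lecR rmorphD/= -!normr_normc ler_normD. Qed.

Lemma normc_sum (f : nat -> R[i]) m :
  normc (\sum_(0 <= k < m) f k) <= \sum_(0 <= k < m) normc (f k).
Proof.
elim: m => [|m ih]; first by rewrite !big_geq// normc0.
by rewrite !big_nat_recr//= (le_trans (normcD _ _))// lerD2r.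
Qed.

Lemma cvg0_normc (u : nat -> R[i]) :
  (u @ \oo --> (0 : R[i]^o)) <-> (normc (u i) @[i --> \oo] --> (0 : R)).
Proof.
split=> [/(@cvgrPdist_lt _ R[i]^o) u0|/cvgrPdist_lt u0].
  apply/cvgrPdist_lt => e e0; have e0C : 0 < e%:C by rewrite ltcR.
  move: (u0 _ e0C); apply: filterS => i /=.
  by rewrite !sub0r !normrN normr_normc ltcR ger0_norm// normc_ge0.
apply/(@cvgrPdist_lt _ R[i]^o) => -[e e'].
rewrite ltcE/= => /andP[/eqP-> e0].
move: (u0 _ e0); apply: filterS => i /=.
by rewrite !sub0r !normrN (ger0_norm (normc_ge0 _)) normr_normc ltcR.
Qed.

End modulus.

Section echelon_space.
Context {R : realType}.
Variable A : kothe_matrix R.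

(** [R[i]^o] is [R[i]] with its modulus topology. *)
Definition lambda0_pred : {pred (nat -> R[i])} :=
  fun x => `[< forall n, (A n i)%:C * x i @[i --> \oo] --> (0 : R[i]^o) >].

Lemma lambda0_predP x : reflect
  (forall n, A n i * normc (x i) @[i --> \oo] --> (0 : R))
  (x \in lambda0_pred).
Proof.
apply: (iffP (asboolP _)) => + n => /(_ n); rewrite cvg0_normc; apply: cvg_trans;
  apply: near_eq_cvg; near=> i => /=;
  by rewrite normcM normc_real// kothe_ge0.
Unshelve. all: by end_near. Qed.

Lemma lambda0_submod_closed : submod_closed lambda0_pred.
Proof.
split.
  apply/lambda0_predP => n; apply: cvg_near_cst; apply: nearW => i /=.
  by rewrite [X in normc X](_ : _ = 0)// normc0 mulr0.
move=> k x y /lambda0_predP xA /lambda0_predP yA; apply/lambda0_predP => n.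
have h : normc k * (A n i * normc (x i)) + A n i * normc (y i) @[i --> \oo]
    --> (0 : R).
  rewrite -[X in _ --> X](addr0 0) -[X in X + _](mulr0 (normc k)).
  by apply: cvgD; [apply: cvgMr; exact: xA|exact: yA].
apply: (@squeeze_cvgr _ _ _ _ (cst 0) _ _ _ _ _ h); last exact: cvg_cst.
near=> i => /=; rewrite [X in normc X](_ : _ = k * x i + y i)//.
rewrite mulr_ge0 ?kothe_ge0 ?normc_ge0//=.
rewrite mulrCA -mulrDr ler_wpM2l ?kothe_ge0//.
by rewrite (le_trans (normcD _ _))// normcM.
Unshelve. all: by end_near. Qed.

HB.instance Definition _ := GRing.isSubmodClosed.Build _ _ lambda0_pred
  lambda0_submod_closed.

Record lambda0 : predArgType := Lambda0 {
  lambda0_val :> nat -> R[i] ;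
  lambda0_valP : lambda0_val \in lambda0_pred }.

HB.instance Definition _ := [isSub for lambda0_val].
HB.instance Definition _ := [Choice of lambda0 by <:].
HB.instance Definition _ := [SubChoice_isSubZmodule of lambda0 by <:].
HB.instance Definition _ := [SubZmodule_isSubLmodule of lambda0 by <:].

Definition kothe_seminorm (n : nat) (x : lambda0) : R :=
  sup (range (fun i => A n i * normc (x i))).

Let p := kothe_seminorm.

Implicit Types x y z : lambda0.

Lemma kothe_seminorm_ub n x i : A n i * normc (x i) <= p n x.
Proof.
apply: ub_le_sup; last by exists i.
have /cvg_seq_bounded : cvgn (fun i => A n i * normc (x i)).
  by apply/cvg_ex; exists 0; exact: (lambda0_predP _ (lambda0_valP x) n).
move=> [M [_ /(_ (M + 1))]]; rewrite ltrDl ltr01 => /(_ isT) h.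
exists (M + 1) => _ [j _ <-]; have := h j I.
by apply: le_trans; exact: ler_norm.
Qed.

Lemma kothe_seminorm_le n x (c : R) :
  (forall i, A n i * normc (x i) <= c) -> p n x <= c.
Proof.
move=> h; apply: ge_sup; first by exists (A n 0 * normc (x 0)); exists 0.
by move=> _ [i _ <-]; exact: h.
Qed.

Lemma kothe_seminorm_ge0 n x : 0 <= p n x.
Proof.
apply: le_trans (kothe_seminorm_ub n x 0).
by rewrite mulr_ge0 ?kothe_ge0 ?normc_ge0.
Qed.

Lemma kothe_seminormD n x y : p n (x + y) <= p n x + p n y.
Proof.
apply: kothe_seminorm_le => i.
apply: le_trans (lerD (kothe_seminorm_ub n x i) (kothe_seminorm_ub n y i)).
by rewrite -mulrDr ler_wpM2l ?kothe_ge0// normcD.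
Qed.

Lemma kothe_seminormZ n (k : R[i]) x : p n (k *: x) <= normc k * p n x.
Proof.
apply: kothe_seminorm_le => i.
rewrite [X in normc X](_ : _ = k * x i)// normcM mulrCA ler_wpM2l ?normc_ge0//.
exact: kothe_seminorm_ub.
Qed.

Lemma kothe_seminorm0 n : p n 0 = 0.
Proof.
apply/eqP; rewrite eq_le kothe_seminorm_ge0 andbT.
by apply: kothe_seminorm_le => i; rewrite [X in normc X](_ : _ = 0)// normc0 mulr0.
Qed.

Lemma kothe_seminorm_mono m n x : (m <= n)%N -> p m x <= p n x.
Proof.
move=> mn; apply: kothe_seminorm_le => i.
apply: le_trans (kothe_seminorm_ub n x i).
rewrite ler_wpM2r ?normc_ge0//.
elim: n mn => [|n ih]; first by rewrite leqn0 => /eqP->.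
rewrite leq_eqVlt => /predU1P[->//|/ih h]; exact: le_trans h (kothe_le _ _ _).
Qed.

Lemma kothe_seminorm_dist n x y z : p n (x - z) <= p n (x - y) + p n (y - z).
Proof.
by rewrite (_ : x - z = (x - y) + (y - z)) ?kothe_seminormD// addrA subrK.
Qed.

(** A single seminorm per neighborhood is enough, since [kothe_seminorm n] is
    nondecreasing in [n]. *)
Definition lambda0_nbhs (x : lambda0) : set_system lambda0 :=
  [set U | exists n (e : R), 0 < e /\ [set y | p n (y - x) < e] `<=` U].

HB.instance Definition _ := hasNbhs.Build lambda0 lambda0_nbhs.

Lemma lambda0_nbhs_ball n (e : R) x y :
  p n (y - x) < e -> nbhs y [set z | p n (z - x) < e].
Proof.
move=> ye; exists n, (e - p n (y - x)); split; first by rewrite subr_gt0.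
move=> z /=; rewrite ltrBrDr; apply: le_lt_trans.
exact: kothe_seminorm_dist.
Qed.

Lemma lambda0_nbhs_filter (x : lambda0) : ProperFilter (nbhs x).
Proof.
apply: Build_ProperFilter_ex; last split.
- by move=> U [n [e [e0 U_]]]; exists x; apply: U_; rewrite /= subrr kothe_seminorm0.
- by exists 0, 1; split.
- move=> U V [n [e [e0 U_]]] [m [d [d0 V_]]].
  exists (maxn n m), (Order.min e d); split; first by rewrite lt_min e0.
  move=> y /=; rewrite lt_min => /andP[ye yd]; split.
    by apply/U_/(le_lt_trans _ ye)/kothe_seminorm_mono/leq_maxl.
  by apply/V_/(le_lt_trans _ yd)/kothe_seminorm_mono/leq_maxr.
- move=> U V UV [n [e [e0 U_]]]; exists n, e; split => //.
  exact: subset_trans UV.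
Qed.

Lemma lambda0_nbhs_singleton (x : lambda0) U : nbhs x U -> U x.
Proof. by move=> [n [e [e0]]]; apply; rewrite /= subrr kothe_seminorm0. Qed.

Lemma lambda0_nbhs_nbhs (x : lambda0) U : nbhs x U -> nbhs x (nbhs^~ U).
Proof.
move=> [n [e [e0 U_]]]; exists n, e; split=> // y /lambda0_nbhs_ball.
by have := lambda0_nbhs_filter y => ?; exact: filterS.
Qed.

HB.instance Definition _ := Nbhs_isNbhsTopological.Build lambda0
  lambda0_nbhs_filter lambda0_nbhs_singleton lambda0_nbhs_nbhs.

Lemma lambda0_add_continuous :
  continuous (fun x : lambda0 * lambda0 => x.1 + x.2).
Proof.
move=> [x y] U /= [n [e [e0 U_]]].
exists ([set z | p n (z - x) < e / 2], [set z | p n (z - y) < e / 2]) => /=.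
  by split; exists n, (e / 2); split=> //; rewrite divr_gt0.
move=> [x' y'] /= [xx' yy']; apply: U_ => /=.
rewrite opprD addrACA (le_lt_trans (kothe_seminormD _ _ _))//.
by rewrite [ltRHS](splitr e) ltrD.
Qed.

Lemma lambda0_scale_continuous :
  continuous (fun z : R[i]^o * lambda0 => z.1 *: z.2).
Proof.
move=> [k x] U /= [n [e [e0 U_]]].
have k0 : 0 < normc k + 1 by rewrite ltr_wpDl ?normc_ge0.
have x0 : 0 < p n x + 1 by rewrite ltr_wpDl ?kothe_seminorm_ge0.
pose d := Order.min 1 (e / 2 / (p n x + 1)).
have d0 : 0 < d by rewrite lt_min ltr01 !divr_gt0.
exists ([set l : R[i]^o | normc (l - k) < d],
        [set z | p n (z - x) < e / 2 / (normc k + 1)]) => /=.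
  split; last by exists n, (e / 2 / (normc k + 1)); split=> //; rewrite !divr_gt0.
  apply/(@nbhs_ballP _ R[i]^o); exists d%:C; first by rewrite /= ltcR.
  by move=> l /=; rewrite -ball_normE/= distrC normr_normc ltcR.
move=> [l z] /= [lk zx]; apply: U_ => /=.
have -> : l *: z - k *: x = l *: (z - x) + (l - k) *: x.
  by rewrite scalerBr scalerBl addrA subrK.
rewrite (le_lt_trans (kothe_seminormD _ _ _))// [ltRHS](splitr e) ltr_leD//.
  rewrite (le_lt_trans (kothe_seminormZ _ _ _))//.
  rewrite (@le_lt_trans _ _ ((normc k + 1) * p n (z - x)))//.
    rewrite ler_wpM2r ?kothe_seminorm_ge0//.
    rewrite -[in leLHS](subrK k l) (le_trans (normcD _ _))// addrC lerD2l ltW//.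
    by rewrite (lt_le_trans lk)// ge_min lexx.
  by rewrite mulrC -ltr_pdivlMr.
rewrite (le_trans (kothe_seminormZ _ _ _))//.
rewrite (@le_trans _ _ (normc (l - k) * (p n x + 1)))//.
  by rewrite ler_wpM2l ?normc_ge0// lerDl.
rewrite -ler_pdivlMr// ltW// (lt_le_trans lk)//.
by rewrite ge_min lexx orbT.
Qed.

Lemma lambda0_locally_convex : exists2 B : set_system lambda0,
  (forall b, b \in B -> convex_set b) & basis B.
Proof.
exists [set b | exists x n e, b = [set y | p n (y - x) < e]].
  move=> b /[!inE] -[x [n [e ->]]]; apply/convex_setW => y z /[!inE]/= ye ze.
  move=> k k0 k1; rewrite /conv/=.
  have kE : k%:num = (normc k%:num)%:C by rewrite -normr_normc gtr0_norm.
  have k1E : unstable.onem k%:num = (1 - normc k%:num)%:C.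
    by rewrite /unstable.onem [in LHS]kE rmorphB.
  have {}k0 : 0 < normc k%:num by rewrite -ltcR -kE.
  have {}k1 : 0 < 1 - normc k%:num by rewrite subr_gt0 -ltcR -kE.
  rewrite inE/= k1E; move: (normc _) kE k0 k1 => r -> r0 r1.
  have -> : r%:C *: y + (1 - r)%:C *: z - x =
      r%:C *: (y - x) + (1 - r)%:C *: (z - x) :> lambda0.
    rewrite !scalerBr addrACA -opprD -scalerDl -rmorphD/=.
    by rewrite [r + _]addrC subrK scale1r.
  rewrite (le_lt_trans (kothe_seminormD _ _ _))//.
  rewrite (_ : e = r * e + (1 - r) * e); last first.
    by rewrite -mulrDl [r + _]addrC subrK mul1r.
  by apply: ltrD; rewrite (le_lt_trans (kothe_seminormZ _ _ _))//
     normc_real ?ltW// ltr_pM2l.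
split.
  by move=> b [x [n [e ->]]]; rewrite openE => y /lambda0_nbhs_ball.
move=> x U [n [e [e0 U_]]]; exists [set y | p n (y - x) < e] => //.
by split; [exists x, n, e|rewrite /= subrr kothe_seminorm0].
Qed.

(** [PreTopologicalLmod_isTvs] only yields the uniform structure; the other
    mixins of [tvsType] have to be supplied separately. *)
HB.instance Definition _ := PreTopologicalLmod_isTvs.Build R[i] lambda0
  lambda0_add_continuous lambda0_scale_continuous lambda0_locally_convex.
HB.instance Definition _ :=
  PreTopologicalNmodule_isTopologicalNmodule.Build lambda0
    lambda0_add_continuous.
HB.instance Definition _ :=
  TopologicalNmodule_isTopologicalLmodule.Build R[i] lambda0
    lambda0_scale_continuous.
HB.instance Definition _ := Uniform_isTvs.Build R[i] lambda0
  lambda0_locally_convex.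

Lemma lambda0_hausdorff : hausdorff_space lambda0.
Proof.
move=> x y xy; apply: val_inj; apply/funext => i /=.
have [n Ani] := kothe_gt0 A i.
apply/eqP; rewrite -subr_eq0; apply/negPn/negP => xy0.
have d0 : 0 < normc (x i - y i).
  rewrite lt0r normc_ge0 andbT; apply: contra xy0 => /eqP/eq0_normc->//.
pose e := A n i * normc (x i - y i) / 2.
have e0 : 0 < e by rewrite divr_gt0 ?mulr_gt0.
have [] := xy [set z | p n (z - x) < e] [set z | p n (z - y) < e].
- by exists n, e; split.
- by exists n, e; split.
move=> z /= [zx zy].
have := ltrD (le_lt_trans (kothe_seminorm_ub _ _ i) zx)
             (le_lt_trans (kothe_seminorm_ub _ _ i) zy).
rewrite -splitr ltNge => /negP; apply; rewrite -mulrDr ler_wpM2l ?kothe_ge0//.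
rewrite [leRHS]addrC (_ : x i - y i = (z - y) i - (z - x) i); last first.
  by rewrite /= opprB [RHS]addrC addrA subrK.
by rewrite (le_trans (normcD _ _))// normcN.
Qed.

End echelon_space.

Record endo_operator (K : numFieldType) (X : tvsType K) := EndoOperator {
  endo_linear :> {linear X -> X} ;
  endo_continuous : continuous endo_linear }.

Section spectrum.
Context {K : numFieldType} {X : tvsType K}.

Definition resolvent_set (T : endo_operator X) : set K :=
  [set l | exists S : endo_operator X,
     cancel (fun x => l *: x - T x) S /\ cancel S (fun x => l *: x - T x)].

Definition spectrum (T : endo_operator X) : set K := ~` resolvent_set T.

End spectrum.

Definition G1_1 (R : realType) (A : kothe_matrix R) : Prop :=
  forall n i, 0 < A n i.+1 /\ A n i.+1 <= A n i.

Definition G1_2 (R : realType) (A : kothe_matrix R) : Prop :=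
  forall n, exists m C, [/\ (n < m)%N, 0 < C &
    forall i, A n i <= C * A m i ^+ 2].

Definition G1_space (R : realType) (A : kothe_matrix R) : Prop :=
  G1_1 A /\ G1_2 A.

Section cesaro_operator.
Context {R : realType} (A : kothe_matrix R) (hA : G1_1 A).
Lemma G1_1_le n i j : (i <= j)%N -> A n j <= A n i.
Proof.
elim: j => [|j ih]; first by rewrite leqn0 => /eqP->.
by rewrite leq_eqVlt => /predU1P[->//|/ih]; apply: le_trans; case: (hA n j).
Qed.

Lemma cesaro_bound n i (x : nat -> R[i]) :
  A n i * normc (arithmetic_mean x i) <=
  arithmetic_mean (fun j => A n j * normc (x j)) i.
Proof.
rewrite /arithmetic_mean/= /series/= normcM.
have -> : normc (i.+1%:R^-1 : R[i]) = i.+1%:R^-1.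
  rewrite (_ : i.+1%:R^-1 = (i.+1%:R^-1 : R)%:C) ?normc_real ?invr_ge0//.
  by rewrite fmorphV rmorph_nat.
rewrite mulrCA ler_wpM2l ?invr_ge0//.
rewrite (le_trans (ler_wpM2l (kothe_ge0 _ _ _) (normc_sum _ _)))//.
rewrite mulr_sumr; apply: ler_sum_nat => j /andP[_ ji].
rewrite ler_wpM2r ?normc_ge0//.
exact: G1_1_le.
Qed.

Lemma cesaro_subproof (x : lambda0 A) :
  (arithmetic_mean x : nat -> R[i]) \in lambda0_pred A.
Proof.
apply/lambda0_predP => n.
have /cesaro h := lambda0_predP _ _ (lambda0_valP x) n.
apply: (@squeeze_cvgr _ _ _ _ (cst 0) _ _ _ _ _ h); last exact: cvg_cst.
apply: nearW => i /=; rewrite mulr_ge0 ?kothe_ge0 ?normc_ge0//=.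
exact: cesaro_bound.
Qed.

Definition cesaro_op (x : lambda0 A) : lambda0 A := Lambda0 (cesaro_subproof x).

Lemma cesaro_op_linear : linear cesaro_op.
Proof.
move=> k x y; apply: val_inj; apply/funext => i /=.
rewrite [RHS](_ : _ = k * arithmetic_mean x i + arithmetic_mean y i)//.
rewrite /arithmetic_mean/= /series/= mulrCA -mulrDr; congr (_ * _).
by rewrite mulr_sumr -big_split.
Qed.

HB.instance Definition _ :=
  GRing.isLinear.Build R[i] (lambda0 A) (lambda0 A) _ cesaro_op cesaro_op_linear.

Lemma cesaro_op_continuous : continuous cesaro_op.
Proof.
move=> x U /= [n [e [e0 U_]]].
exists n, e; split=> // y /= yx; apply: U_ => /=.
rewrite -raddfB; apply: le_lt_trans yx; apply: kothe_seminorm_le => i.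
apply: (le_trans (cesaro_bound _ _ _)).
rewrite /arithmetic_mean/= /series/= ler_pdivrMl//.
rewrite (le_trans (ler_sum _ (fun j _ => kothe_seminorm_ub n (y - x) j)))//.
by rewrite sumr_const_nat subn0 mulr_natl.
Qed.

Definition cesaro_operator : endo_operator (lambda0 A) :=
  @EndoOperator _ (lambda0 A) cesaro_op cesaro_op_continuous.

End cesaro_operator.

(** The inverse is taken in [\bar R], so that a zero entry makes the series
    diverge. *)
Definition summability_exponents (R : realType) (A : kothe_matrix R) (n : nat)
  : set R :=
  [set s | (\sum_(0 <= i <oo) ((i.+1%:R `^ s * A n i)%:E)^-1 < +oo)%E].

Definition s0 (R : realType) (A : kothe_matrix R) (n : nat) : R :=
  inf (summability_exponents A n).

Definition unit_fractions (R : realType) : set R[i] :=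
  range (fun k : nat => k.+1%:R^-1).
Arguments unit_fractions : clear implicits.

Definition tangent_disk (R : realType) (r : R) : set R[i] :=
  [set l | normc (l - ((2 * r)^-1)%:C) < (2 * r)^-1].

(* Main.v *)
(** Summability of 1/(i^s a_n(i)) gives a_n(i) >= c i^(-s), and (G1-2) turns such
    a bound into a_m(i) >= c' i^(-s/2) for some m > n. Hence for every e > 0 some
    a_m dominates a multiple of i^(-e), so that s_0(m) can be made as close to 1
    as desired, while s_0 >= 1 by divergence of the harmonic series; the disks
    D(s_0(n)) thus exhaust D(1).

    For 0 <> l with Re(1/l) > 1, or l = 1, the formal eigenvector
    phi_i = \prod_(j < i) (1 - 1/(l j)) of the transpose of C is O(i^(-s)) for
    some s > 1. If (l - C) x = e_1, pairing with phi and telescoping yields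
    l phi_(N+1) N (C x)_N = 1 for all N; but |(C x)_N| <= M / a_m(N) = O(N^e)
    with e < s - 1, a contradiction. So l - C is not surjective. *)
Require Import Defs.
From mathcomp Require Import all_boot all_order all_algebra complex.
From mathcomp Require Import all_classical all_reals all_analysis.
From mathcomp Require Import ring lra.

Import Order.TTheory GRing.Theory Num.Theory.
Import numFieldNormedType.Exports.
Import ComplexField.Normc.

Local Open Scope classical_set_scope.
Local Open Scope ring_scope.

Set Implicit Arguments.
Unset Strict Implicit.
Unset Printing Implicit Defensive.
Local Arguments normc : simpl never.

(** * Real powers and sums of (i+1)^(-(1+q)) *)

(** With t = y/x this is t^q >= 1 + q ln t combined with ln t >= 1 - 1/t. It needs no order between
    [x] and [y]: both orders occur below. *)
Lemma powR_bernoulli (R : realType) (x y q : R) : 0 < x -> 0 < y -> 0 <= q ->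
  (1 + q * (1 - x / y)) * x `^ q <= y `^ q.
Proof.
move=> x0 y0 q0; have xy0 : 0 < x / y by exact: divr_gt0.
have -> : y `^ q = (y / x) `^ q * x `^ q.
  by rewrite -powRM ?divr_ge0 ?ltW// divfK ?gt_eqF.
rewrite ler_wpM2r ?powR_ge0// -(invf_div x y) /powR gt_eqF ?invr_gt0//.
apply: le_trans (expR_ge1Dx _); rewrite lerD2l ler_wpM2l// lnV// lerNr opprB.
by have := @le_ln1Dx _ (x / y - 1); rewrite (addrC 1) subrK; apply; lra.
Qed.

(** Bernoulli at x = j+1, y = j+2, divided by x^q y^q; it stands in for the integral comparison. *)
Lemma powRN_telescope (R : realType) (q : R) (j : nat) : 0 <= q ->
  q * j.+2%:R `^ (- (1 + q)) <= j.+1%:R `^ (- q) - j.+2%:R `^ (- q).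
Proof.
move=> q0; have p1 : (0 : R) < j.+1%:R by [].
have p2 : (0 : R) < j.+2%:R by [].
have := powR_bernoulli p1 p2 q0.
have u0 := powR_gt0 q p1; have v0 := powR_gt0 q p2.
rewrite !powRN powRD; last by rewrite (gt_eqF p2) implybT.
rewrite powRr1 ?(ltW p2)//.
move: (_ `^ q) (j.+2%:R `^ q) u0 v0 => u v u0 v0.
rewrite -[j.+2%:R]natr1 in p2 *; move: (j.+1%:R) p1 p2 => x x0 x1 h.
rewrite -subr_ge0 (_ : _ - _ = (v - (1 + q * (1 - x / (x + 1))) * u) / (u * v)).
  by rewrite divr_ge0 ?subr_ge0// mulr_ge0 ?ltW.
by field; rewrite !gt_eqF.
Qed.

Lemma powRN_partial_sum_le (R : realType) (q : R) (n : nat) : 0 < q ->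
  \sum_(0 <= i < n) i.+1%:R `^ (- (1 + q)) <= 1 + q^-1.
Proof.
move=> q0; case: n => [|n]; first by rewrite big_geq// addr_ge0// invr_ge0 ltW.
(* The induction needs the boundary term of the telescoped sum, which is dropped only afterwards. *)
apply: (@le_trans _ _ (1 + q^-1 * (1 - n.+1%:R `^ (- q)))); last first.
  by rewrite lerD2l ler_piMr ?invr_ge0 ?ltW// gerBl powR_ge0.
elim: n => [|n ih]; first by rewrite big_nat1 !powR1 subrr mulr0 addr0.
rewrite big_nat_recr//=; apply: le_trans (lerD ih (lexx _)) _.
rewrite -addrA lerD2l -lerBrDl -mulrBr ler_pdivlMl//.
by apply: le_trans (powRN_telescope n (ltW q0)) _; lra.
Qed.

Lemma powR_natr_unbounded (R : realType) (d K : R) : 0 < d ->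
  exists n : nat, K < n.+1%:R `^ d.
Proof.
(* The maximum with 0 makes raising to 1/d and then to d return the base. *)
move=> d0; exists (Num.truncn (Num.max K 0 `^ d^-1)).
have /(gt0_ltr_powR d0) : Num.max K 0 `^ d^-1 <
  (Num.truncn (Num.max K 0 `^ d^-1)).+1%:R by exact: truncnS_gt.
rewrite -powRrM mulVf ?gt_eqF// powRr1 ?le_max ?lexx ?orbT//.
move=> /(_ (powR_ge0 _ _) (ler0n _ _)); apply: le_lt_trans.
by rewrite le_max lexx.
Qed.

(** * The disks D(r) *)

Lemma normc_sqr (R : realType) (z : R[i]) :
  normc z ^+ 2 = complex.Re z ^+ 2 + complex.Im z ^+ 2.
Proof. by case: z => a b; rewrite sqr_sqrtr// addr_ge0// sqr_ge0. Qed.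

(** Squaring gives a condition monotone in [r]; for l nonzero it reads r < Re(1/l). *)
Lemma tangent_diskE (R : realType) (r : R) (l : R[i]) : 0 < r ->
  tangent_disk r l <-> r * normc l ^+ 2 < complex.Re l.
Proof.
move=> r0; rewrite /tangent_disk/=.
rewrite -(ltr_pXn2r (n := 2))// ?nnegrE ?normc_ge0 ?invr_ge0 ?mulr_ge0 ?ltW//.
rewrite !normc_sqr; case: l => a b /=; rewrite oppr0 addr0.
rewrite -subr_gt0 -[in X in _ <-> X]subr_gt0.
have -> : (2 * r)^-1 ^+ 2 - ((a - (2 * r)^-1) ^+ 2 + b ^+ 2) =
  r^-1 * (a - r * (a ^+ 2 + b ^+ 2)).
  by field; rewrite gt_eqF.
by rewrite pmulr_rgt0 ?invr_gt0.
Qed.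

(** * Power lower bounds on the weights and summability exponents *)

Definition power_minorized (R : realType) (e : R) (u : nat -> R) :=
  exists2 c : R, 0 < c & forall i, c * i.+1%:R `^ (- e) <= u i.

Lemma power_minorized_le (R : realType) (e e' : R) (u : nat -> R) :
  e <= e' -> power_minorized e u -> power_minorized e' u.
Proof.
move=> ee' [c c0 h]; exists c => // i; apply: le_trans (h i).
by rewrite ler_pM2l// ler_powR ?lerN2// ler1n.
Qed.

Lemma power_minorized_sqr (R : realType) (e C : R) (u v : nat -> R) :
  0 < C -> (forall i, 0 <= v i) -> (forall i, u i <= C * v i ^+ 2) ->
  power_minorized e u -> power_minorized (e / 2) v.
Proof.
move=> C0 v0 uv [c c0 h]; exists (Num.sqrt (c / C)).
  by rewrite sqrtr_gt0 divr_gt0.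
move=> i; rewrite -ler_sqr ?nnegrE ?mulr_ge0 ?sqrtr_ge0 ?powR_ge0//.
rewrite exprMn sqr_sqrtr ?(divr_ge0 (ltW c0) (ltW C0))//.
rewrite -powR_mulrn ?powR_ge0// -powRrM.
rewrite mulNr divfK// -(ler_pM2l C0) (le_trans _ (uv i))// (le_trans _ (h i))//.
by rewrite mulrA mulrCA divff ?gt_eqF// mulr1.
Qed.

Lemma G1_2_power_minorized (R : realType) (A : kothe_matrix R) (n : nat)
    (e e' : R) : G1_2 A -> power_minorized e (A n) -> 0 < e' ->
  exists m, power_minorized e' (A m).
Proof.
move=> A2 An e'0.
have H k : exists m, power_minorized (e / 2 ^+ k) (A m).
  elim: k => [|k [m Am]]; first by exists n; rewrite expr0 divr1.
  have [m' [C [_ C0 mm']]] := A2 m; exists m'.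
  rewrite exprSr invfM mulrA.
  exact: power_minorized_sqr C0 (kothe_ge0 A m') mm' Am.
(* The number k of halvings exceeds e/e', and 2^k > k, so e/2^k <= e'. *)
have [m Am] := H (Num.truncn (e / e')).+1; exists m.
apply: power_minorized_le Am; rewrite ler_pdivrMr ?exprn_gt0// -ler_pdivrMl//.
rewrite mulrC (le_trans (ltW (truncnS_gt _)))// -natrX ler_nat.
exact/ltnW/ltn_expl.
Qed.

(** Positive weights make the inverse in [\bar R] a real inverse, so the series has nonnegative real
    terms and converges exactly when its partial sums are bounded. *)
Lemma summability_exponentsP (R : realType) (A : kothe_matrix R) n s :
  (forall i, 0 < A n i) -> summability_exponents A n s <->
  exists M : R, forall k,
    \sum_(0 <= i < k) (i.+1%:R `^ s * A n i)^-1 <= M.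
Proof.
move=> A0; rewrite /summability_exponents/=.
have t0 i : 0 < (i.+1%:R `^ s * A n i)^-1.
  by rewrite invr_gt0 mulr_gt0// powR_gt0.
have -> : (fun k => \sum_(0 <= i < k) ((i.+1%:R `^ s * A n i)%:E)^-1)%E =
          (fun k => \sum_(0 <= i < k) ((i.+1%:R `^ s * A n i)^-1)%:E)%E.
  apply/funext => k; apply: eq_bigr => i _.
  by rewrite inver gt_eqF// -invr_gt0.
have f0 k : (0 <= k)%N -> true -> (0 <= ((k.+1%:R `^ s * A n k)^-1)%:E)%E.
  by rewrite lee_fin ltW.
split=> [h|[M h]].
  have /fineK E :
      (\sum_(0 <= i <oo) ((i.+1%:R `^ s * A n i)^-1)%:E)%E \is a fin_num.
    by rewrite ge0_fin_numE// nneseries_ge0.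
  exists (fine (\sum_(0 <= i <oo) ((i.+1%:R `^ s * A n i)^-1)%:E)%E) => k.
  rewrite -lee_fin E -sumEFin.
  exact: nneseries_lim_ge.
apply: (@le_lt_trans _ _ M%:E); last exact: ltry.
apply: lime_le; first exact: is_cvg_nneseries.
by apply: nearW => k; rewrite sumEFin lee_fin.
Qed.

Lemma summability_power_minorized (R : realType) (A : kothe_matrix R) n s :
  (forall i, 0 < A n i) -> summability_exponents A n s ->
  power_minorized s (A n).
Proof.
move=> A0 /(summability_exponentsP _ A0)[M h].
have t0 i : 0 < i.+1%:R `^ s * A n i by rewrite mulr_gt0// powR_gt0.
have tM i : (i.+1%:R `^ s * A n i)^-1 <= M.
  apply: le_trans (h i.+1); rewrite big_nat_recr//= lerDr.
  by apply: sumr_ge0 => j _; rewrite invr_ge0 ltW.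
have M0 : 0 < M by apply: lt_le_trans (tM 0); rewrite invr_gt0.
exists M^-1 => [|i]; first by rewrite invr_gt0.
rewrite powRN ler_pdivrMr ?powR_gt0// mulrC.
by rewrite -(lef_pV2 (t0 i) _) ?invrK ?posrE ?invr_gt0.
Qed.

(** Partial converse, losing 1 in the exponent: the terms are at most c^-1 (i+1)^(-(s-e)), with s -
    e > 1. *)
Lemma power_minorized_summability (R : realType) (A : kothe_matrix R) n e s :
  (forall i, 0 < A n i) -> power_minorized e (A n) -> 1 + e < s ->
  summability_exponents A n s.
Proof.
move=> A0 [c c0 h] es; apply/summability_exponentsP => //.
exists (c^-1 * (1 + (s - e - 1)^-1)) => k.
have q0 : 0 < s - e - 1 by lra.
rewrite (le_trans _ (ler_wpM2l _ (powRN_partial_sum_le k q0)))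
  ?invr_ge0 ?(ltW c0)//.
rewrite mulr_sumr; apply: ler_sum => i _.
have i0 : (0 : R) < i.+1%:R by [].
rewrite powRN -invfM lef_pV2 ?posrE ?mulr_gt0 ?powR_gt0//.
have -> : 1 + (s - e - 1) = s - e by ring.
by rewrite powRD ?(gt_eqF i0) ?implybT// mulrCA ler_wpM2l ?powR_ge0.
Qed.

Lemma G1_1_gt0 (R : realType) (A : kothe_matrix R) :
  G1_1 A -> forall n i, 0 < A n i.
Proof. by move=> A1 n i; have [h1 h2] := A1 n i; exact: lt_le_trans h2. Qed.

Lemma summability_exponents_ge1 (R : realType) (A : kothe_matrix R) n :
  G1_1 A -> lbound (summability_exponents A n) 1.
Proof.
move=> A1 s; have A0 := G1_1_gt0 A1 n.
move=> /(summability_exponentsP _ A0)[M h]; rewrite leNgt; apply/negP => s1.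
apply: (@dvg_harmonic R); apply: nondecreasing_is_cvgn.
  apply/nondecreasing_seqP => k; rewrite /series/= big_nat_recr//= lerDl.
  by rewrite invr_ge0.
(* For s < 1, (i+1)^s <= i+1 and [A n i <= A n 0], so the bound [M] would bound the harmonic
   series. *)
exists (A n 0 * M) => _ [k _ <-].
rewrite (le_trans _ (ler_wpM2l _ (h k))) ?(ltW (A0 0))//.
rewrite mulr_sumr; apply: ler_sum => i _ /=.
rewrite invfM mulrCA -[leLHS]mulr1 ler_pM// ?invr_ge0//.
  by rewrite lef_pV2 ?posrE ?powR_gt0// ler1_powR// ?ler1n// ltW.
by rewrite ler_pdivlMr// mul1r; exact: G1_1_le.
Qed.

(** * The dual eigenvector and its decay *)

(** For [z = l^-1] these are the coordinates of the solution [phi] of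
    [phi \o C = l *: phi] normalized by [phi 0 = 1]. *)
Definition cesaro_dual_eigenvector (R : realType) (z : R[i]) (n : nat) : R[i] :=
  \prod_(0 <= j < n) (1 - z / j.+1%:R).

(** Partial sums of the pairing of [phi] with [(l - C) x], in closed form, so
    that [phi] need not be known to be a continuous functional. *)
Lemma cesaro_dual_telescope (R : realType) (l : R[i]) (x : nat -> R[i]) n :
  l != 0 ->
  \sum_(0 <= i < n)
    cesaro_dual_eigenvector l^-1 i * (l * x i - arithmetic_mean x i) =
  l * cesaro_dual_eigenvector l^-1 n * series x n.
Proof.
move=> l0; elim: n => [|n ih]; first by rewrite /series/= !big_geq// mulr0.
(* Both sides equal phi_n (l - 1/(n+1)) times the sum of x_0, ..., x_n. *)
rewrite big_nat_recr//= ih /arithmetic_mean/= /series/= big_nat_recr//=.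
rewrite /cesaro_dual_eigenvector big_nat_recr//=.
have n0 : (n.+1%:R : R[i]) != 0 by rewrite pnatr_eq0.
rewrite -natr1 in n0 *; by field; rewrite n0.
Qed.

Lemma nonincreasing_from_ub (R : realType) (u : nat -> R) J :
  (forall n, 0 <= u n) -> (forall n, (J <= n)%N -> u n.+1 <= u n) ->
  exists K, forall n, u n <= K.
Proof.
(* The sum of the first J+1 terms replaces their maximum. *)
move=> u0 h; exists (\sum_(0 <= i < J.+1) u i) => n.
have H m : (m <= J)%N -> u m <= \sum_(0 <= i < J.+1) u i.
  move=> mJ; rewrite big_mkord (bigD1 (Ordinal (mJ : (m < J.+1)%N)))//= lerDl.
  exact: sumr_ge0.
have [/H//|/ltnW] := leqP n J.
elim: n => [|n ih]; first by rewrite leqn0 => /eqP J0; apply: H; rewrite J0.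
rewrite leq_eqVlt => /predU1P[<-|Jn]; first exact: H.
exact: le_trans (h _ Jn) (ih Jn).
Qed.

Lemma normc_sub1_div (R : realType) (z : R[i]) (y : R) : y != 0 ->
  normc (1 - z / (y%:C)%C) ^+ 2 =
  1 - 2 * complex.Re z / y + normc z ^+ 2 / y ^+ 2.
Proof.
move=> y0; rewrite -fmorphV !normc_sqr; case: z => a b /=.
by field.
Qed.

(** [`|1 - z / n|^2 = 1 - 2 Re z / n + O(n^-2)] is eventually at most
    [1 - 2 s / n <= (n / (n + 1)) `^ (2 s)], so [`|phi n| * n `^ s] is
    eventually nonincreasing. *)
Lemma cesaro_dual_decay (R : realType) (z : R[i]) (s : R) :
  0 <= s -> s < complex.Re z ->
  exists K, forall n, normc (cesaro_dual_eigenvector z n) * n.+1%:R `^ s <= K.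
Proof.
(* For n >= J, |z|^2 <= 2 (Re z - s) (n+1): the linear gain absorbs the quadratic term of |1 -
   z/(n+1)|^2. *)
move=> s0 sz; pose J := Num.truncn (normc z ^+ 2 / (2 * (complex.Re z - s))).
apply: (@nonincreasing_from_ub _ _ J) => [n|n Jn].
  by rewrite mulr_ge0 ?normc_ge0 ?powR_ge0.
rewrite /cesaro_dual_eigenvector big_nat_recr//= normcM -mulrA.
rewrite ler_wpM2l ?normc_ge0//.
have y0 : (0 : R) < n.+1%:R by [].
have x0 : (0 : R) < n.+2%:R by [].
have zy : normc z ^+ 2 / (2 * (complex.Re z - s)) <= n.+1%:R.
  by rewrite (le_trans (ltW (truncnS_gt _)))// ler_nat.
rewrite ler_pdivrMr in zy; last lra.
rewrite -ler_sqr ?nnegrE ?mulr_ge0 ?normc_ge0 ?powR_ge0//.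
have -> : n.+1%:R = (n.+1%:R%:C)%C :> R[i] by rewrite rmorph_nat.
have sq (x : R) : (x `^ s) ^+ 2 = x `^ (s * 2).
  by rewrite -powR_mulrn ?powR_ge0// powRrM.
rewrite exprMn normc_sub1_div ?gt_eqF// !sq.
have s20 : 0 <= s * 2 by lra.
(* Here Bernoulli runs downwards, from n+2 to n+1, so 1 - x/y = -1/(n+1). *)
apply: le_trans (powR_bernoulli x0 y0 s20); rewrite ler_wpM2r ?powR_ge0//.
rewrite -[n.+2%:R]natr1; move: (n.+1%:R) y0 zy => y y0 zy.
rewrite -subr_ge0.
have -> : 1 + s * 2 * (1 - (y + 1) / y) -
    (1 - 2 * complex.Re z / y + normc z ^+ 2 / y ^+ 2) =
    (y * (2 * (complex.Re z - s)) - normc z ^+ 2) / y ^+ 2.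
  by field; rewrite gt_eqF.
by rewrite divr_ge0 ?sqr_ge0// subr_ge0.
Qed.

(** * Spectral points from decay of the dual eigenvector *)

Lemma lambda0_delta0_subproof (R : realType) (A : kothe_matrix R) :
  (fun i : nat => (i == 0)%:R : R[i]) \in lambda0_pred A.
Proof.
apply/lambda0_predP => n; apply: cvg_near_cst; exists 1%N => // -[|i] //= _.
by rewrite [X in normc X](_ : _ = 0)// normc0 mulr0.
Qed.

Lemma cesaro_spectrum (R : realType) (A : kothe_matrix R) (hA : G1_1 A)
    (l : R[i]) (s K : R) :
  (forall e : R, 0 < e -> exists m, power_minorized e (A m)) ->
  l != 0 -> 1 < s ->
  (forall n, normc (cesaro_dual_eigenvector l^-1 n) * n.+1%:R `^ s <= K) ->
  spectrum (cesaro_operator hA) l.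
Proof.
move=> Alb l0 s1 phiK [S [_ SK]].
pose e0 := Lambda0 (lambda0_delta0_subproof A).
pose x := S e0; pose y := cesaro_op hA x.
have xE i : l * x i - arithmetic_mean x i = (i == 0)%:R.
  by have /(congr1 (fun v : lambda0 A => v i)) := SK e0.
have phi1 n : l * cesaro_dual_eigenvector l^-1 n.+1 * (n.+1%:R * y n) = 1.
  rewrite (_ : y n = n.+1%:R^-1 * series x n.+1)// mulVKf ?pnatr_eq0//.
  rewrite -cesaro_dual_telescope// big_nat_recl//= xE big1 => [|i _].
    by rewrite /cesaro_dual_eigenvector big_geq// mulr1 addr0.
  by rewrite xE mulr0.
(* With d = (s-1)/2, y_n is O(n^d) while n phi_(n+1) is O(n^(-2d)); their product, of constant
   modulus 1/|l|, would be O(n^(-d)). Multiplying by (n+1)^d gives the bound [B] on (n+1)^d for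
   every n. *)
have d0 : 0 < (s - 1) / 2 by lra.
have [m [c c0 Am]] := Alb _ d0.
pose B : R := normc l * K * (kothe_seminorm m y / c).
have [n] := powR_natr_unbounded B d0; apply/negP; rewrite -leNgt.
have n0 : (0 : R) < n.+1%:R by [].
have yn : normc (y n) <= kothe_seminorm m y / c * n.+1%:R `^ ((s - 1) / 2).
  rewrite mulrAC ler_pdivlMr// -[leLHS]mulrC -ler_pdivrMr ?powR_gt0//.
  rewrite mulrAC -powRN (le_trans _ (kothe_seminorm_ub m y n))//.
  by rewrite ler_wpM2r ?normc_ge0.
have phin : normc (cesaro_dual_eigenvector l^-1 n.+1) * n.+1%:R `^ s <= K.
  rewrite (le_trans _ (phiK n.+1))// ler_wpM2l ?normc_ge0//.
  by rewrite ge0_ler_powR ?nnegrE ?ler_nat//; lra.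
have phi1n : normc l * normc (cesaro_dual_eigenvector l^-1 n.+1) *
    (n.+1%:R * normc (y n)) = 1.
  rewrite -[RHS](@normc1 R) -(phi1 n) (normcM (l * _)) (normcM l).
  rewrite (normcM n.+1%:R).
  have -> : n.+1%:R = (n.+1%:R%:C)%C :> R[i] by rewrite rmorph_nat.
  by rewrite normc_real.
rewrite -[leLHS]mul1r -[X in X * _ <= _]phi1n.
have E : n.+1%:R `^ s = n.+1%:R * n.+1%:R `^ ((s - 1) / 2) ^+ 2 :> R.
  rewrite -powR_mulrn ?powR_ge0// -powRrM divfK// mulr_powRB1//.
  by rewrite (lt_trans ltr01).
rewrite E in phin; rewrite /B.
have a0 := normc_ge0 l.
have p0 := normc_ge0 (cesaro_dual_eigenvector l^-1 n.+1).
have t0 := powR_ge0 n.+1%:R ((s - 1) / 2) : 0 <= _ :> R.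
have Q0 : 0 <= kothe_seminorm m y / c.
  by rewrite divr_ge0 ?kothe_seminorm_ge0 ?ltW.
move: (normc l) (normc (cesaro_dual_eigenvector l^-1 n.+1)) (normc (y n))
  a0 p0 t0 Q0 yn phin.
move: (n.+1%:R `^ ((s - 1) / 2)) (kothe_seminorm m y / c)
  => t Q a p v a0 p0 t0 Q0 yn phin.
apply: (@le_trans _ _ (a * p * n.+1%:R * t * (Q * t))).
  rewrite [leLHS](_ : _ = a * p * n.+1%:R * t * v); last by ring.
  by rewrite ler_wpM2l// !mulr_ge0// ltW.
rewrite [leLHS](_ : _ = a * Q * (p * (n.+1%:R * t ^+ 2))); last by ring.
rewrite [leRHS](_ : _ = a * Q * K); last by ring.
by rewrite ler_wpM2l// mulr_ge0.
Qed.

(** * Exhaustion of D(1) and the spectral inclusion *)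

Lemma ReV (R : realType) (l : R[i]) :
  complex.Re l^-1 = complex.Re l / normc l ^+ 2.
Proof. by rewrite normc_sqr; case: l. Qed.

Lemma cesaro_dual_eigenvector1 (R : realType) n :
  cesaro_dual_eigenvector (1 : R[i]) n.+1 = 0.
Proof.
by rewrite /cesaro_dual_eigenvector big_nat_recl//= divr1 subrr mul0r.
Qed.

Lemma G1_space_power_minorized (R : realType) (A : kothe_matrix R) (e : R) :
  G1_space A -> (exists n, summability_exponents A n !=set0) -> 0 < e ->
  exists m, power_minorized e (A m).
Proof.
move=> [A1 A2] [n [s /(summability_power_minorized (G1_1_gt0 A1 n))An]] e0.
exact: G1_2_power_minorized A2 An e0.
Qed.

Lemma s0_ge1 (R : realType) (A : kothe_matrix R) n :
  G1_1 A -> summability_exponents A n !=set0 -> 1 <= s0 A n.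
Proof.
by move=> A1 An; apply: lb_le_inf => //; exact: summability_exponents_ge1.
Qed.

Lemma s0_lt (R : realType) (A : kothe_matrix R) (a : R) :
  G1_space A -> (exists n, summability_exponents A n !=set0) -> 1 < a ->
  exists2 n, summability_exponents A n !=set0 & s0 A n < a.
Proof.
(* Thirds leave room for two strict inequalities: the witness 1 + 2(a-1)/3 lies above the threshold
   1 + (a-1)/3 and below [a]. *)
move=> hA A_exp a1; have e0 : 0 < (a - 1) / 3 by lra.
have A1 := proj1 hA.
have [m Am] := G1_space_power_minorized hA A_exp e0.
have Sm s : 1 + (a - 1) / 3 < s -> summability_exponents A m s.
  exact: power_minorized_summability (G1_1_gt0 A1 m) Am.
exists m; first by exists a; apply: Sm; lra.
apply: (@le_lt_trans _ _ (1 + 2 * ((a - 1) / 3))); last lra.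
apply: ge_inf; last by apply: Sm; lra.
by exists 1; exact: summability_exponents_ge1.
Qed.

(** A point of D(1) has Re(1/l) > 1, and [s0_lt] finds an n with s_0(n) below that value; conversely
    s_0(n) >= 1 shrinks each disk into D(1). *)
Lemma bigcup_tangent_disk_s0 (R : realType) (A : kothe_matrix R) :
  G1_space A -> (exists n0, summability_exponents A n0 !=set0) ->
  \bigcup_(n in [set n | summability_exponents A n !=set0])
    tangent_disk (s0 A n) = tangent_disk (1 : R).
Proof.
move=> hA A_exp; apply/seteqP; split=> l.
  move=> [n /= /(s0_ge1 (proj1 hA)) s1].
  rewrite !tangent_diskE ?(lt_le_trans ltr01)//.
  by apply: le_lt_trans; rewrite ler_wpM2r ?sqr_ge0.
rewrite tangent_diskE// mul1r => ll.
have l0 : 0 < normc l ^+ 2.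
  rewrite lt0r sqr_ge0 andbT sqrf_eq0; apply: contraTN ll => /eqP/eq0_normc ->.
  by rewrite normc0 expr0n ltxx.
have : 1 < complex.Re l / normc l ^+ 2 by rewrite ltr_pdivlMr// mul1r.
move=> /(s0_lt hA A_exp)[n An sn]; exists n => //.
rewrite tangent_diskE -?ltr_pdivlMr//.
exact: lt_le_trans ltr01 (s0_ge1 (proj1 hA) An).
Qed.

Lemma unit_fractions_sub (R : realType) :
  unit_fractions R `<=` tangent_disk (1 : R) `|` [set 1].
Proof.
move=> _ [[|k] _ <-]; [by right; rewrite /= invr1|left].
have -> : k.+2%:R^-1 = (k.+2%:R^-1%:C)%C :> R[i] by rewrite fmorphV rmorph_nat.
rewrite tangent_diskE// mul1r normc_real ?invr_ge0//=.
rewrite -[ltRHS]mulr1 expr2 ltr_pM2l ?invr_gt0// invf_lt1//.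
by rewrite ltr1n.
Qed.

Theorem proposition9 (R : realType) (A : kothe_matrix R) (hA : G1_space A)
  (A_cvg0 : forall n, A n i @[i --> \oo] --> (0 : R))
  (A_exp : exists n0, summability_exponents A n0 !=set0) :
  tangent_disk (1 : R) `|` [set 1] =
    (\bigcup_(n in [set n | summability_exponents A n !=set0])
      tangent_disk (s0 A n)) `|` unit_fractions R /\
  (\bigcup_(n in [set n | summability_exponents A n !=set0])
      tangent_disk (s0 A n)) `|` unit_fractions R
    `<=` spectrum (cesaro_operator (proj1 hA)).
Proof.
rewrite bigcup_tangent_disk_s0//.
have E : tangent_disk (1 : R) `|` [set 1] = tangent_disk 1 `|` unit_fractions R.
  apply/seteqP; split=> l [l1|]; [by left| |by left|exact: unit_fractions_sub].
  by move=> /= ->; right; exists 0%N => //; rewrite invr1.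
have minorized (e : R) := @G1_space_power_minorized _ _ e hA A_exp.
split=> //; rewrite -E => l [|/= ->]; last first.
  (* At l = 1 the first factor vanishes, so phi_n = 0 for n >= 1 and any exponent above 1 would
     do. *)
  apply: (@cesaro_spectrum _ _ _ _ 2 1) minorized _ _ _ => //.
  - by rewrite ltr1n.
  - move=> n; rewrite invr1; case: n => [|n].
      by rewrite /cesaro_dual_eigenvector big_geq// normc1 powR1 mulr1.
    by rewrite cesaro_dual_eigenvector1 normc0 mul0r.
rewrite tangent_diskE// mul1r => ll.
have l0 : l != 0.
  by apply: contraTneq ll => ->; rewrite normc0 expr0n ltxx.
have l2 : 0 < normc l ^+ 2.
  rewrite lt0r sqr_ge0 andbT sqrf_eq0; by apply: contra l0 => /eqP/eq0_normc ->.
have a1 : 1 < complex.Re l^-1 by rewrite ReV ltr_pdivlMr// mul1r.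
(* The midpoint is below Re(1/l), as the decay requires, and above 1, as the contradiction
   requires. *)
pose s := (1 + complex.Re l^-1) / 2.
have [||K phiK] := @cesaro_dual_decay _ l^-1 s; [rewrite /s; lra..|].
by apply: cesaro_spectrum minorized l0 _ phiK; rewrite /s; lra.
Qed.
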